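(* Let $p$ be a prime and let $G$ be a non-abelian $p$-group of order $p^n$ whose derived subgroup $G'$ has order $|G'|=p$. Then the non-abelian tensor square $G\otimes G$ satisfies \[|G\otimes G|\leq p^{(n-1)^2+2},\] and equality holds if and only if $G$ is isomorphic to $H\times E$, where $H\cong E_1$ or $H\cong Q_8$, and $E$ is an elementary abelian $p$-group.
   Context: For a group $G$, write ${}^g g'=gg'g^{-1}$. The non-abelian tensor square $G\otimes G$ is the group generated by the symbols $g\otimes h$ ($g,h\in G$) subject to the relations \[gg'\otimes h=({}^g g'\otimes {}^g h)(g\otimes h),\qquad g\otimes hh'=(g\otimes h)({}^h g\otimes {}^h h')\] for all $g,g',h,h'\in G$. The derived subgroup of $G$ is denoted $G'$. $E_1$ denotes the extra-special $p$-group of order $p^3$ and exponent $p$ (which exists only for $p$ odd), and $Q_8$ denotes the quaternion group of order $8$ (relevant only for $p=2$). The elementary abelian group $E$ is allowed to be trivial. *)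

(* Defs.v *)
From HB Require Import structures.
From mathcomp Require Import all_boot all_fingroup all_solvable.
From mathcomp Require Import generic_quotient.
From mathcomp Require Import boolp classical_sets cardinality.

Set Implicit Arguments.
Unset Strict Implicit.
Unset Printing Implicit Defensive.

Local Open Scope group_scope.
Local Open Scope quotient_scope.

Section Presentation.

Variable X : choiceType.

(* The letter (x, false) stands for x and (x, true) for its inverse. *)
Definition word := seq (X * bool).

Definition letter_inv (l : X * bool) : X * bool := (l.1, ~~ l.2).

Definition word_inv (w : word) : word := rev (map letter_inv w).

Variable R : word -> word -> Prop.

(* The congruence on words generated by R and free cancellation. *)
Inductive word_eq : word -> word -> Prop :=
| word_eq_refl u : word_eq u u
| word_eq_sym u v : word_eq u v -> word_eq v u
| word_eq_trans v u w : word_eq u v -> word_eq v w -> word_eq u w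
| word_eq_cat u u' v v' :
    word_eq u u' -> word_eq v v' -> word_eq (u ++ v) (u' ++ v')
| word_eq_cancel l : word_eq [:: l; letter_inv l] [::]
| word_eq_rel u v : R u v -> word_eq u v.

Definition word_eqb : rel word := fun u v => `[< word_eq u v >].

Lemma word_eqb_refl : reflexive word_eqb.
Proof. by move=> u; apply/asboolP; apply: word_eq_refl. Qed.

Lemma word_eqb_sym : symmetric word_eqb.
Proof. by move=> u v; apply/asboolP/asboolP; apply: word_eq_sym. Qed.

Lemma word_eqb_trans : transitive word_eqb.
Proof.
by move=> v u w /asboolP uv /asboolP vw; apply/asboolP/(word_eq_trans uv).
Qed.

Canonical word_equiv :=
  EquivRel word_eqb word_eqb_refl word_eqb_sym word_eqb_trans.

Definition presented : Type := {eq_quot word_equiv}.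

HB.instance Definition _ := EqQuotient.on presented.
HB.instance Definition _ := Choice.on presented.

Lemma presented_eqP (u v : word) :
  \pi_presented u = \pi_presented v <-> word_eq u v.
Proof.
by split=> [/eqmodP/asboolP // | uv]; apply/eqmodP/asboolP.
Qed.

Lemma word_eq_repr (u : word) : word_eq (repr (\pi_presented u)) u.
Proof. by apply/presented_eqP; rewrite reprK. Qed.

Lemma letter_invK : involutive letter_inv.
Proof. by case=> x b; rewrite /letter_inv /= negbK. Qed.

Lemma word_inv_cons l w : word_inv (l :: w) = word_inv w ++ [:: letter_inv l].
Proof. by rewrite /word_inv /= rev_cons cats1. Qed.

Lemma word_invK : involutive word_inv.
Proof.
by move=> w; rewrite /word_inv map_rev revK mapK //; exact: letter_invK.
Qed.

Lemma word_eq_mulV w : word_eq (w ++ word_inv w) [::].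
Proof.
elim: w => [|l w IHw]; first exact: word_eq_refl.
rewrite word_inv_cons -cat1s -catA [w ++ _]catA.
apply: word_eq_trans (word_eq_cancel l).
rewrite -[X in word_eq _ X]/([:: l] ++ [:: letter_inv l]).
apply: word_eq_cat (word_eq_refl _) _.
exact: word_eq_cat IHw (word_eq_refl _).
Qed.

Lemma word_eq_mulVw w : word_eq (word_inv w ++ w) [::].
Proof. by rewrite -{2}(word_invK w); apply: word_eq_mulV. Qed.

Definition presented_one : presented := \pi_presented [::].
Definition presented_mul (a b : presented) : presented :=
  \pi_presented (repr a ++ repr b).
Definition presented_inv (a : presented) : presented :=
  \pi_presented (word_inv (repr a)).

Lemma presented_mulA : associative presented_mul.
Proof.
move=> a b c; apply/presented_eqP.
apply: (@word_eq_trans (repr a ++ repr b ++ repr c)).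
  exact: word_eq_cat (word_eq_refl _) (word_eq_repr _).
rewrite catA; apply: word_eq_sym.
exact: word_eq_cat (word_eq_repr _) (word_eq_refl _).
Qed.

Lemma presented_mul1g : left_id presented_one presented_mul.
Proof.
move=> a; rewrite -[RHS]reprK; apply/presented_eqP.
rewrite -[X in word_eq _ X]cat0s.
exact: word_eq_cat (word_eq_repr _) (word_eq_refl _).
Qed.

Lemma presented_mulg1 : right_id presented_one presented_mul.
Proof.
move=> a; rewrite -[RHS]reprK; apply/presented_eqP.
rewrite -[X in word_eq _ X]cats0.
exact: word_eq_cat (word_eq_refl _) (word_eq_repr _).
Qed.

Lemma presented_mulVg :
  left_inverse presented_one presented_inv presented_mul.
Proof.
move=> a; apply/presented_eqP; apply: word_eq_trans (word_eq_mulVw (repr a)).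
exact: word_eq_cat (word_eq_repr _) (word_eq_refl _).
Qed.

Lemma presented_mulgV :
  right_inverse presented_one presented_inv presented_mul.
Proof.
move=> a; apply/presented_eqP; apply: word_eq_trans (word_eq_mulV (repr a)).
exact: word_eq_cat (word_eq_refl _) (word_eq_repr _).
Qed.

HB.instance Definition _ := isGroup.Build presented
  presented_mulA presented_mul1g presented_mulg1
  presented_mulVg presented_mulgV.

End Presentation.

Section TensorSquare.

Variable T : groupType.

(* This is gxg^{-1}; MathComp's x ^ g is g^{-1}xg. *)
Definition lconj (g x : T) : T := g * x * g^-1.

Definition tensor_letter (g h : T) : (T * T) * bool := ((g, h), false).

Inductive tensor_rel : word (T * T)%type -> word (T * T)%type -> Prop :=
| tensor_rel_l (g g' h : T) :
    tensor_rel [:: tensor_letter (g * g') h]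
      [:: tensor_letter (lconj g g') (lconj g h); tensor_letter g h]
| tensor_rel_r (g h h' : T) :
    tensor_rel [:: tensor_letter g (h * h')]
      [:: tensor_letter g h; tensor_letter (lconj h g) (lconj h h')].

Definition tensor_square : groupType := presented tensor_rel.

End TensorSquare.

(* No group satisfies this for p = 2: a group of exponent 2 is abelian. *)
Definition is_E1 (p : nat) (hT : finGroupType) (H : {group hT}) : Prop :=
  [/\ extraspecial H, #|H| = (p ^ 3)%N & exponent H = p].

(* Main.v *)
From HB Require Import structures.
Require Import Defs.
From mathcomp Require Import boolp classical_sets cardinality.
From mathcomp Require Import all_boot all_fingroup all_solvable all_algebra.
From mathcomp Require Import ring mxabelem.

Set Implicit Arguments.
Unset Strict Implicit.
Unset Printing Implicit Defensive.

(** Put D = G^`(1) and let T be the tensor square of G. As D has order p, it is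
    central, so G has class 2. (In the lemmas G is the full group of a
    finite group type W.) In T the generator of (g, h) conjugates like the
    commutator of g and h, which acts trivially here; hence T is abelian and can be written additively. A map to an
    abelian group that satisfies the defining relations of T is called a crossed
    pairing; everything about T is read off from the universal one,
    (g, h) |-> t g h.

    Upper bound. Expanding t (g g') h and t g (h h') in two ways gives
    t k [g, h] = - t [g, h] k and the Jacobi identity
    t [g, h] k + t [h, k] g + t [k, g] h = 0 (pair_skew, pair_Jacobi). Fix x, y
    with z = [x, y] <> 1, so that D = <z>. By Jacobi the subgroup J spanned by
    t D G and t G D consists of the combinations a (t z x) + b (t z y) with
    a, b < p, so |J| <= p^2. Modulo J the pairing is bilinear on G / D. Climbing
    from D to G through subgroups of index p, each of the n - 1 steps adjoins
    the values t k h for one new k, and modulo what is already there they only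
    depend on h modulo the Frattini subgroup (pair_layer). Hence
    |T| <= p^2 |G : Phi(G)|^(n-1) <= p^((n-1)^2 + 2).

    Equality forces Phi(G) = D and, for every pair x, y that does not commute,
    independence modulo p of t z x and t z y (extremal_Phi, extremal_indep).
    All the structure follows from this independence. If k commutes with x and
    y, then t z k = 0 by Jacobi, so k cannot belong to a noncommuting pair:
    k is central. If c is central, then p (t c k) = t c (k^p) = 0 because
    k^p is in D, so c^p <> 1 would make t z vanish: the centre is elementary
    abelian. Comparing t (x^p) y with t x (y^p) gives a relation between t z x
    and t z y whose coefficients force x^p = 1 for p odd and x^2 = y^2 = z for
    p = 2. So G is the product of the group <x, y>, of order p^3, with a
    complement of D in the centre.

    Converse. If G = H x E as in the statement, then G / D is elementary abelian
    of rank n - 1, and the bilinear map to square matrices of size n - 1 sees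
    p^((n-1)^2) elements of T. That map kills J, so it remains to find one
    crossed pairing on H which takes p^2 values on pairs (z, h): it is given
    explicitly by heis_pairing for E_1 and by quat_pairing for Q_8. *)

Import GRing.Theory.
Local Open Scope ring_scope.
Local Open Scope group_scope.

(** * Crossed pairings on a group of class 2 *)

(** The defining relations of the tensor square, for a map to an abelian
    group: such maps are the homomorphisms from the tensor square to A. *)
Definition crossed_pairing (W : groupType) (A : zmodType) (t : W -> W -> A) :=
  (forall g g' h, t (g * g') h = t (lconj g g') (lconj g h) + t g h) /\
  (forall g h h', t g (h * h') = t g h + t (lconj h g) (lconj h h')).

Definition central (W : groupType) (z : W) := forall k : W, commute z k.

Section ClassTwo.

Variables (W : finGroupType) (A : zmodType) (t : W -> W -> A).
Hypothesis tP : crossed_pairing t.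
Hypothesis cW : forall g h : W, central [~ g, h].

Lemma class2_lconjE (g x : W) : lconj g x = [~ g, x] * x.
Proof.
by rewrite /lconj [g * x]commgC -mulgA (cW _ _ g^-1) mulgA mulgK -(cW _ _ x).
Qed.

Lemma lconj_central_l (z x : W) : central z -> lconj z x = x.
Proof. by move=> cz; rewrite /lconj (cz x) mulgK. Qed.

Lemma lconj_central_r (g z : W) : central z -> lconj g z = z.
Proof. by move=> cz; rewrite /lconj -(cz g) mulgK. Qed.

Lemma class2_mulC (g h : W) : g * h = [~ g, h] * (h * g).
Proof. by rewrite [LHS]commgC -(cW _ _ (h * g)). Qed.

Lemma pairMl_central (z g h : W) : central z -> t (z * g) h = t g h + t z h.
Proof. by move=> cz; rewrite tP.1 !lconj_central_l. Qed.

Lemma pairMr_central (z g h : W) : central z -> t g (z * h) = t g z + t g h.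
Proof. by move=> cz; rewrite tP.2 !lconj_central_l. Qed.

(** Expand t z (h g) directly, and again after writing h g = [h, g] (g h):
    as z acts trivially, all terms but t z [g, h] cancel. Hence t z is a
    homomorphism on W. *)
Lemma pair_central_comm (z g h : W) : central z -> t z [~ g, h] = 0.
Proof.
move=> cz; have := erefl (t z (h * g)).
rewrite {1}(tP.2 z h g) (lconj_central_r _ cz) class2_lconjE.
rewrite (pairMr_central _ _ (cW _ _)).
rewrite (class2_mulC h g) (pairMr_central _ _ (cW _ _)).
rewrite (tP.2 z g h) (lconj_central_r _ cz) class2_lconjE.
rewrite (pairMr_central _ _ (cW _ _)).
rewrite !addrA [RHS](ACl (3 * (4 * 1 * 2)))%AC /= => E.
by apply: (addIr (t z h + t z [~ h, g] + t z g)); rewrite add0r -E.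
Qed.

(** The action of g moves g' and h by central factors [g, g'] and [g, h],
    which pairMl_central and pairMr_central split off. *)
Lemma pairMl (g g' h : W) :
  t (g * g') h = t g h + t g' h + t [~ g, g'] h + t g' [~ g, h].
Proof.
rewrite tP.1 !class2_lconjE (pairMl_central _ _ (cW _ _)).
rewrite !(pairMr_central _ _ (cW _ _)).
rewrite (pair_central_comm g h (cW g g')) ?add0r.
by rewrite [LHS](ACl (4*2*3*1))%AC.
Qed.

Lemma pairMr (g h h' : W) :
  t g (h * h') = t g h + t g h' + t [~ h, g] h' + t g [~ h, h'].
Proof.
rewrite tP.2 !class2_lconjE (pairMl_central _ _ (cW _ _)).
rewrite !(pairMr_central _ _ (cW _ _)).
rewrite (pair_central_comm h h' (cW h g)) ?add0r.
by rewrite !addrA [LHS](ACl (1*3*4*2))%AC.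
Qed.

Lemma central_comm1 (z g : W) : central z -> [~ g, z] = 1.
Proof. by move=> cz; apply/eqP/commgP/esym/cz. Qed.

Lemma central1 : central (1 : W).
Proof. by move=> k; rewrite /commute mulg1 mul1g. Qed.

Lemma pair1l (h : W) : t 1 h = 0.
Proof.
apply: (addrI (t 1 h)).
by rewrite addr0 -(pairMl_central _ _ central1) mulg1.
Qed.

Lemma pair1r (g : W) : t g 1 = 0.
Proof.
apply: (addrI (t g 1)).
by rewrite addr0 -(pairMr_central _ _ central1) mulg1.
Qed.

Lemma pairZMr (z g h : W) : central z -> t z (g * h) = t z g + t z h.
Proof.
move=> cz; rewrite pairMr (pair_central_comm _ _ cz) central_comm1 // pair1l.
by rewrite !addr0.
Qed.

Lemma pairZXr (z g : W) i : central z -> t z (g ^+ i) = t z g *+ i.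
Proof.
move=> cz; elim: i => [|i IH]; first by rewrite expg0 pair1r.
by rewrite expgS pairZMr // IH mulrS.
Qed.

Lemma pairZXl (z h : W) i : central z -> t (z ^+ i) h = t z h *+ i.
Proof.
move=> cz; elim: i => [|i IH]; first by rewrite expg0 pair1l.
by rewrite expgS (pairMl_central _ _ cz) IH mulrSr.
Qed.

Lemma pairXZr (g z : W) i : central z -> t g (z ^+ i) = t g z *+ i.
Proof.
move=> cz; elim: i => [|i IH]; first by rewrite expg0 pair1r.
by rewrite expgS (pairMr_central _ _ cz) IH mulrS.
Qed.

Lemma pair_commVl (g h k : W) : t [~ h, g] k = - t [~ g, h] k.
Proof.
apply/eqP; rewrite -addr_eq0 addrC -(pairMl_central _ _ (cW _ _)) -invg_comm.
by rewrite mulVg pair1l.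
Qed.

Lemma pair_commVr (g h k : W) : t k [~ h, g] = - t k [~ g, h].
Proof.
apply/eqP; rewrite -addr_eq0 -(pairMr_central _ _ (cW _ _)) -invg_comm.
by rewrite mulVg pair1r.
Qed.

(** Compare the expansions of t (g g') h and of t (g' g) h. *)
Lemma pair_comm_swapl (g g' h : W) :
  t [~ g, g'] h + t g' [~ g, h] = t g [~ g', h].
Proof.
have := pairMl g g' h; rewrite (class2_mulC g g').
rewrite (pairMl_central _ _ (cW g g')) (pairMl g' g) pair_commVl.
rewrite addrAC addrNK [t g h + t g' h]addrC => E.
by apply: (addrI (t g' h + t g h)); rewrite E addrA.
Qed.

Lemma pair_comm_swapr (g h h' : W) :
  t [~ h, g] h' + t g [~ h, h'] = t [~ h', g] h.
Proof.
have := pairMr g h h'; rewrite (class2_mulC h h').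
rewrite (pairMr_central _ _ (cW h h')) (pairMr g h' h) (pair_commVr h h').
rewrite [X in X = _ -> _]addrC addrNK [t g h + t g h']addrC => E.
by apply: (addrI (t g h' + t g h)); rewrite E addrA.
Qed.

(** Both sides come out of the two swap identities. Thus t W D and t D W
    span the same subgroup. *)
Lemma pair_skew (g h k : W) : t k [~ g, h] = - t [~ g, h] k.
Proof.
rewrite -pair_commVl -(pair_comm_swapr g k h) -(pair_comm_swapl g k h).
by rewrite [t [~ k, g] h]pair_commVl addKr.
Qed.

Lemma pair_Jacobi (g h k : W) : t [~ g, h] k + t [~ h, k] g + t [~ k, g] h = 0.
Proof.
have := pair_comm_swapr g k h; rewrite pair_skew -pair_commVl.
rewrite [t [~ h, g] k]pair_commVl => E.
by rewrite -addrA [t [~ h, k] g + _]addrC E addrN.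
Qed.

(** The action makes t (_) y quadratic in the exponent: the i-th factor x
    contributes t (x^i) [x, y] = - i (t [x, y] x). *)
Lemma pairXl (x y : W) i :
  t (x ^+ i) y = t x y *+ i - t [~ x, y] x *+ 'C(i, 2).
Proof.
elim: i => [|i IH]; first by rewrite expg0 pair1l !mulr0n subr0.
rewrite expgS pairMl IH (pair_skew x y) (pairZXr _ _ (cW x y)).
have -> : [~ x, x ^+ i] = 1 by apply/eqP/commgP/commuteX.
rewrite pair1l addr0 binS bin1 mulrS mulrnDr opprD.
by rewrite !addrA.
Qed.

Lemma pairXr (x y : W) i :
  t x (y ^+ i) = t x y *+ i - t [~ x, y] y *+ 'C(i, 2).
Proof.
elim: i => [|i IH]; first by rewrite expg0 pair1r !mulr0n subr0.
rewrite expgS pairMr IH (pair_commVl x y) (pairZXr _ _ (cW x y)).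
have -> : [~ y, y ^+ i] = 1 by apply/eqP/commgP/commuteX.
rewrite pair1r addr0 binS bin1 mulrS mulrnDr opprD.
by rewrite !addrA.
Qed.

Lemma class2_commMl (g h k : W) : [~ g * h, k] = [~ g, k] * [~ h, k].
Proof. by rewrite commMgJ conjgE (cW g k h) mulKg. Qed.

Lemma class2_commXl (g k : W) i : [~ g ^+ i, k] = [~ g, k] ^+ i.
Proof. by apply: commXg; apply/commute_sym/cW. Qed.

End ClassTwo.

(** * Climbing through subgroups of index p *)

Section Layer.

Variables (W : finGroupType) (A : zmodType) (t : W -> W -> A) (p : nat).
Hypothesis tP : crossed_pairing t.
Hypothesis cW : forall g h : W, central [~ g, h].
Hypothesis p_prime : prime p.
Hypothesis pW : p.-group [set: W].

Local Notation D := ([set: W]^`(1)).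
Local Notation Phi := ('Phi([set: W])).

Lemma commW_der1 (g h : W) : [~ g, h] \in D.
Proof. by rewrite mem_commg ?inE. Qed.

Variables (s : seq A) (K1 K : {group W}).
Hypotheses (s0 : 0 \in s) (sB : {in s &, forall u v, u - v \in s}).
Hypotheses (sDK1 : D \subset K1) (maxK1 : maximal K1 K).
Hypothesis sK1 : forall k h, k \in K1 -> t k h \in s.

Let sN u : u \in s -> - u \in s.
Proof. by move=> su; rewrite -sub0r sB. Qed.

Let sD u v : u \in s -> v \in s -> u + v \in s.
Proof. by move=> su sv; rewrite -[v]opprK sB ?sN. Qed.

Let s_comml g h k : t [~ g, h] k \in s.
Proof. by rewrite sK1 // (subsetP sDK1) ?commW_der1. Qed.

Let s_commr g h k : t k [~ g, h] \in s.
Proof. by rewrite pair_skew // sN. Qed.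

Let sMl g g' h : t (g * g') h - (t g h + t g' h) \in s.
Proof.
by rewrite (pairMl tP cW) -(addrA (t g h + _)) [X in X - _]addrC addrK sD.
Qed.

Let sMr g h h' : t g (h * h') - (t g h + t g h') \in s.
Proof.
by rewrite (pairMr tP cW) -(addrA (t g h + _)) [X in X - _]addrC addrK sD.
Qed.

Let s_eq u v : u - v \in s -> (u \in s) = (v \in s).
Proof.
move=> suv; apply/idP/idP => [su | sv]; last by rewrite -(subrK v u) sD.
by rewrite -[v](subKr u) sB.
Qed.

Let sXl g i h : t (g ^+ i) h - t g h *+ i \in s.
Proof.
elim: i => [|i IH]; first by rewrite expg0 pair1l // subrr.
rewrite expgS mulrS -(subrK (t g h + t (g ^+ i) h) (t _ h)) -addrA sD ?sMl //.
by rewrite opprD addrACA subrr add0r.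
Qed.

Let sXr g h i : t g (h ^+ i) - t g h *+ i \in s.
Proof.
elim: i => [|i IH]; first by rewrite expg0 pair1r // subrr.
rewrite expgS mulrS -(subrK (t g h + t g (h ^+ i)) (t g _)) -addrA sD ?sMr //.
by rewrite opprD addrACA subrr add0r.
Qed.

(** Modulo s the map t x is a homomorphism on W, and it kills p-th powers,
    because p (t x h) is t (x^p) h modulo s and x^p lies in K1. *)
Lemma pair_Phi_in x : x \in K -> forall h, h \in Phi -> t x h \in s.
Proof.
move=> Kx.
have B_group : group_set [set h | t x h \in s].
  apply/group_setP; split=> [|h h']; rewrite !inE ?pair1r //.
  by move=> sh sh'; rewrite (s_eq (sMr _ _ _)) sD.
suff sPhiB : Phi \subset Group B_group.
  by move=> h /(subsetP sPhiB); rewrite inE.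
rewrite (Phi_joing pW) join_subG (MhoE 1 pW) !gen_subG; apply/andP; split.
  by apply/subsetP=> _ /imset2P[g h _ _ ->]; rewrite inE.
apply/subsetP=> _ /imsetP[h _ ->]; rewrite inE expn1.
rewrite (s_eq (sXr _ _ _)) -(s_eq (sXl _ _ _)) sK1 //.
have pK : p.-group K := pgroupS (subsetT _) pW.
have nK1K := p_maximal_normal pK maxK1.
have nK1x := subsetP (normal_norm nK1K) x Kx.
rewrite coset_idr ?groupX // morphX //=; apply/eqP.
rewrite -order_dvdn -(p_maximal_index pK maxK1) -card_quotient ?normal_norm //.
by rewrite order_dvdG ?mem_quotient.
Qed.

(** The list s stands for the subgroup spanned by t K1 W. Adjoining t x h,
    for x in K outside K1 and h in a transversal of the Frattini subgroup,
    spans t K W: the other elements of K are k1 x^i, and t (x^i) h is t x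
    (h^i) modulo s. *)
Lemma pair_layer : exists s' : seq A,
  [/\ size s' = (size s * #|[set: W] : Phi|)%N,
      0 \in s', {in s' &, forall u v, u - v \in s'}
    & forall k h, k \in K -> t k h \in s'].
Proof.
have pK : p.-group K := pgroupS (subsetT _) pW.
have nK1K := p_maximal_normal pK maxK1.
have [x Kx notK1x] : exists2 x, x \in K & x \notin K1.
  by have /maxgroupp/properP[] := maxK1.
pose s' := [seq u + t x (repr c) | u <- s, c <- enum (rcosets Phi [set: W])].
have s'P u h : u \in s -> u + t x h \in s'.
  move=> su; set r := repr (Phi :* h).
  have -> : u + t x h = (u + (t x h - t x r)) + t x r by rewrite -addrA subrK.
  apply/allpairsP; exists (u + (t x h - t x r), Phi :* h) => /=; split => //.
    rewrite sD //; have /rcosetP[a Pa Er] := mem_repr_rcoset 'Phi([set: W]) h.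
    rewrite -[t x h]opprK -opprB opprK sN // -/r /r Er.
    rewrite -(subrK (t x a + t x h) (t x (a * h))) -addrA sD ?sMr //.
    by rewrite addrK (pair_Phi_in Kx).
  by rewrite mem_enum; apply/rcosetsP; exists h; rewrite ?inE.
exists s'; split.
- by rewrite size_allpairs -cardE.
- by have := s'P 0 1 s0; rewrite (pair1r tP) addr0.
- move=> _ _ /allpairsP[[u c] /= [su _ ->]] /allpairsP[[v d] /= [sv _ ->]].
  rewrite -(mulgKV (repr d) (repr c)).
  set h := _ * (repr d)^-1; set h' := repr d.
  have -> : u + t x (h * h') - (v + t x h') =
            (u - v + (t x (h * h') - (t x h + t x h'))) + t x h.
    rewrite opprD addrACA -[RHS]addrA; congr (_ + _).
    by rewrite opprD addrA addrAC subrK.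
  by rewrite s'P // sD // sB.
move=> k h.
rewrite -(mulg_normal_maximal nK1K maxK1 (H := <[x]>)) ?cycle_subG //.
case/mulsgP=> k1 _ K1k1 /cycleP[i ->] ->.
have -> : t (k1 * x ^+ i) h =
  (t (k1 * x ^+ i) h - (t k1 h + t (x ^+ i) h) + t k1 h
   + (t (x ^+ i) h - t x h *+ i) - (t x (h ^+ i) - t x h *+ i)) + t x (h ^+ i).
  rewrite opprB -(addrA _ (_ - _) (t x _)) subrK -(addrA _ (_ - _)) subrK.
  by rewrite -(addrA _ (t k1 h)) subrK.
apply: s'P; apply: sB; first apply: sD; first apply: sD;
  by rewrite ?sMl ?sXl ?sXr ?sK1.
Qed.

End Layer.

Section Cover.

Variables (W : finGroupType) (A : zmodType) (t : W -> W -> A) (p : nat).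
Hypothesis tP : crossed_pairing t.
Hypothesis cW : forall g h : W, central [~ g, h].
Hypothesis p_prime : prime p.
Hypothesis pW : p.-group [set: W].

Local Notation D := ([set: W]^`(1)).
Local Notation Phi := ('Phi([set: W])).

Lemma pair_cover (s : seq A) :
    0 \in s -> {in s &, forall u v, u - v \in s} ->
    (forall k h, k \in D -> t k h \in s) ->
  exists s' : seq A,
  [/\ size s' = (size s * #|[set: W] : Phi| ^ logn p #|[set: W] : D|)%N,
      0 \in s', {in s' &, forall u v, u - v \in s'}
    & forall g h, t g h \in s'].
Proof.
move=> s0 sB sDt.
suff main (K : {group W}) : D \subset K -> exists s' : seq A,
    [/\ size s' = (size s * #|[set: W] : Phi| ^ logn p #|K : D|)%N,
      0 \in s', {in s' &, forall u v, u - v \in s'}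
    & forall k h, k \in K -> t k h \in s'].
  have [s' [size_s' s'0 s'B s't]] := main [group of [set: W]] (der_sub 1 _).
  by exists s'; split=> // g h; rewrite s't ?inE.
have [m] := ubnP #|K|; elim: m K => // m IH K leKm sDK.
have pK : p.-group K := pgroupS (subsetT _) pW.
have [<- | [K1 maxK1 sDK1]] := maximal_exists sDK.
  by exists s; rewrite indexgg logn1 expn0 muln1; split.
have ltK1 : (#|K1| < #|K|)%N by rewrite proper_card ?(maxgroupp maxK1).
have [s1 [size_s1 s10 s1B s1t]] := IH K1 (leq_trans ltK1 leKm) sDK1.
have [s2 [size_s2 s20 s2B s2t]] := pair_layer tP cW pW s10 s1B sDK1 maxK1 s1t.
exists s2; split=> //; rewrite size_s2 size_s1 -mulnA -expnSr.
have sK1K : K1 \subset K := proper_sub (maxgroupp maxK1).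
rewrite -(Lagrange_index sK1K sDK1) lognM ?indexg_gt0 //.
by rewrite (p_maximal_index pK maxK1) (logn_prime p p_prime) eqxx.
Qed.

End Cover.

(** * The upper bound *)

Section Extremal.

Variables (W : finGroupType) (A : zmodType) (t : W -> W -> A) (p n : nat).
Hypothesis tP : crossed_pairing t.
Hypothesis cW : forall g h : W, central [~ g, h].
Hypothesis p_prime : prime p.
Hypothesis oW : #|W| = (p ^ n)%N.

Local Notation D := ([set: W]^`(1)).
Local Notation Phi := ('Phi([set: W])).
Hypothesis oD : #|D| = p.

Let p_gt0 : (0 < p)%N := prime_gt0 p_prime.

Let pW : p.-group [set: W].
Proof. by rewrite /pgroup cardsT oW pnatX pnat_id. Qed.

Lemma der1_cycle (x y : W) : [~ x, y] != 1 -> D = <[[~ x, y]]>.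
Proof.
move=> nz; apply/esym/eqP; rewrite eqEcard cycle_subG commW_der1 /= oD.
have: (#[[~ x, y]] %| p)%N by rewrite -oD cardSg // cycle_subG commW_der1.
case/primeP: p_prime => _ /[apply] /orP[|/eqP oz].
  by rewrite order_eq1 (negPf nz).
by rewrite -{1}oz orderE.
Qed.

Lemma comm_expp (x y : W) : [~ x, y] ^+ p = 1.
Proof. by rewrite -oD expg_cardG ?commW_der1. Qed.

Lemma der1_comm_exp (x y u : W) : [~ x, y] != 1 -> u \in D ->
  exists i, u = [~ x, y] ^+ i.
Proof. by move=> nz; rewrite (der1_cycle nz) => /cycleP. Qed.

Lemma pair_comm_mulrp (x y k : W) : t [~ x, y] k *+ p = 0.
Proof. by rewrite -(pairZXl tP) // comm_expp (pair1l tP). Qed.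

(** Once x and y do not commute, these sums exhaust the subgroup spanned by
    t D W. *)
Definition pair_comb (x y : W) (ab : 'I_p * 'I_p) : A :=
  t [~ x, y] x *+ ab.1 + t [~ x, y] y *+ ab.2.

Lemma pair_comb_mod (x y : W) a b :
  t [~ x, y] x *+ a + t [~ x, y] y *+ b =
  pair_comb x y (Ordinal (ltn_pmod a p_gt0), Ordinal (ltn_pmod b p_gt0)).
Proof.
rewrite /pair_comb /= {1}(divn_eq a p) {1}(divn_eq b p) !mulrnDr.
by rewrite ![(_ * p)%N]mulnC !mulrnA !pair_comm_mulrp !mul0rn !add0r.
Qed.

Section Noncommuting.

Variables x y : W.
Hypothesis nz : [~ x, y] != 1.

Lemma mem_pair_comb a b :
  t [~ x, y] x *+ a + t [~ x, y] y *+ b \in codom (pair_comb x y).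
Proof. by rewrite pair_comb_mod codom_f. Qed.

Lemma pair_comb0 : 0 \in codom (pair_comb x y).
Proof. by have := mem_pair_comb 0 0; rewrite !mulr0n addr0. Qed.

Lemma pair_combB : {in codom (pair_comb x y) &, forall u v,
  u - v \in codom (pair_comb x y)}.
Proof.
move=> _ _ /codomP[[a b] ->] /codomP[[c d] ->].
have oppE (k : W) (i : 'I_p) : - (t [~ x, y] k *+ i) = t [~ x, y] k *+ (p - i).
  by rewrite mulrnBr ?pair_comm_mulrp ?sub0r // ltnW.
by rewrite /pair_comb /= opprD addrACA !oppE -!mulrnDr mem_pair_comb.
Qed.

(** By the Jacobi identity for x, y, h, the value t [x, y] h is a
    combination of t [x, y] x and t [x, y] y, since [y, h] and [h, x] are
    powers of [x, y]. *)
Lemma pair_der1_comb k h : k \in D -> t k h \in codom (pair_comb x y).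
Proof.
case/(der1_comm_exp nz)=> i ->; rewrite (pairZXl tP) //.
have [a Ea] := der1_comm_exp nz (commW_der1 h y).
have [b Eb] := der1_comm_exp nz (commW_der1 x h).
have := pair_Jacobi tP cW x y h; rewrite -addrA => /eqP; rewrite addr_eq0.
rewrite opprD -!(pair_commVl tP cW) Ea Eb !(pairZXl tP) // => /eqP->.
by rewrite mulrnDl -!mulrnA mem_pair_comb.
Qed.

Let m := n.-1.

Lemma noncommuting_card_gt2 : (2 < n)%N.
Proof.
rewrite ltnNge; apply: contra nz => le_n2; apply/commgP.
have abW : abelian [set: W].
  by apply: (p2group_abelian pW); rewrite cardsT oW pfactorK.
by apply: (centsP abW); rewrite inE.
Qed.

Let m_gt0 : (0 < m)%N.
Proof. by rewrite -ltnS prednK ?(ltn_trans _ noncommuting_card_gt2). Qed.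

Lemma index_der1 : #|[set: W] : D| = (p ^ m)%N.
Proof.
apply/eqP; rewrite -(eqn_pmul2l p_gt0) -{1}oD Lagrange ?der_sub // cardsT oW.
by rewrite -expnS prednK // (ltn_trans _ noncommuting_card_gt2).
Qed.

Lemma der1_sub_Phi : D \subset Phi.
Proof. by rewrite (Phi_joing pW) joing_subl. Qed.

Lemma pair_cover_dim (s : seq A) :
    0 \in s -> {in s &, forall u v, u - v \in s} ->
    (forall k h, k \in D -> t k h \in s) ->
  exists s' : seq A,
  [/\ size s' = (size s * #|[set: W] : Phi| ^ m)%N,
      0 \in s', {in s' &, forall u v, u - v \in s'}
    & forall g h, t g h \in s'].
Proof.
move=> s0 sB sDt; have [s' Hs'] := pair_cover tP cW p_prime pW s0 sB sDt.
by exists s'; rewrite index_der1 pfactorK // in Hs'.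
Qed.

Lemma index_Phi_leq : (#|[set: W] : Phi| <= p ^ m)%N.
Proof.
by rewrite -index_der1 dvdn_leq ?indexg_gt0 // indexgS // der1_sub_Phi.
Qed.

Lemma pair_upper_bound : exists s : seq A,
  [/\ (size s <= p ^ (m ^ 2 + 2))%N,
      0 \in s, {in s &, forall u v, u - v \in s} & forall g h, t g h \in s].
Proof.
have [s [size_s s0 sB st]] :=
  pair_cover_dim pair_comb0 pair_combB pair_der1_comb.
exists s; split=> //; rewrite size_s size_codom card_prod card_ord.
rewrite mulnn expnD [leqRHS]mulnC leq_mul2l; apply/orP; right.
by rewrite (expnM _ m m) leq_exp2r ?m_gt0 ?index_Phi_leq.
Qed.

Hypothesis t_large : forall s : seq A,
  0 \in s -> {in s &, forall u v, u - v \in s} -> (forall g h, t g h \in s) ->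
  (p ^ (m ^ 2 + 2) <= size s)%N.

(** Were the Frattini subgroup larger than D, each layer would lose a factor
    p. *)
Lemma extremal_Phi : Phi = D.
Proof.
have [s [size_s s0 sB st]] :=
  pair_cover_dim pair_comb0 pair_combB pair_der1_comb.
have := t_large s0 sB st; rewrite size_s size_codom card_prod card_ord.
rewrite mulnn expnD [leqLHS]mulnC leq_pmul2l ?expn_gt0 ?p_gt0 //.
rewrite (expnM _ m m) leq_exp2r ?m_gt0 // -index_der1 => le_ind.
apply/eqP; rewrite eq_sym eqEcard der1_sub_Phi /=.
have := Lagrange (der_sub 1 [set: W]); rewrite -(Lagrange (Phi_sub [set: W])).
move=> E; rewrite -(leq_pmul2r (indexg_gt0 [set: W] D)) E leq_pmul2l //.
Qed.

(** If two combinations coincided, then removing duplicates would give a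
    cover that is too small. *)
Lemma extremal_inj : injective (pair_comb x y).
Proof.
pose s := undup (codom (pair_comb x y)).
have s0 : 0 \in s by rewrite mem_undup pair_comb0.
have sB : {in s &, forall u v, u - v \in s}.
  by move=> u v; rewrite !mem_undup; apply: pair_combB.
have st k h : k \in D -> t k h \in s.
  by rewrite mem_undup; apply: pair_der1_comb.
have [s' [size_s' s'0 s'B s't]] := pair_cover_dim s0 sB st.
apply/injectiveP; rewrite /injectiveb /dinjectiveb -/(codom _).
rewrite -[uniq _]negbK -ltn_size_undup -leqNgt size_codom card_prod card_ord.
have := t_large s'0 s'B s't; rewrite size_s' expnD mulnC => le_s.
have := leq_trans le_s (leq_mul (leqnn _) _).
rewrite (expnM _ m m) => /(_ ((p ^ m) ^ m)%N); rewrite leq_exp2r ?m_gt0 //.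
move/(_ index_Phi_leq); rewrite leq_pmul2r ?expn_gt0 ?p_gt0 //.
Qed.

Lemma extremal_indep a b :
  t [~ x, y] x *+ a + t [~ x, y] y *+ b = 0 -> (p %| a)%N /\ (p %| b)%N.
Proof.
have := pair_comb_mod x y 0 0; rewrite !mulr0n addr0 => {1}->.
by rewrite pair_comb_mod => /extremal_inj[]; rewrite mod0n => /eqP ? /eqP.
Qed.

End Noncommuting.

End Extremal.

(** * Groups that attain the bound *)

Lemma isog_setX (gT : finGroupType) (G H E : {group gT}) :
  H \x E = G -> G \isog setX H E.
Proof.
move=> defG; apply: (isog_dprod defG (setX_dprod H E)).
  by rewrite -morphim_pairg1 sub_isog ?injm_pairg1 ?subsetT.
by rewrite -morphim_pair1g sub_isog ?injm_pair1g ?subsetT.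
Qed.

Lemma center_centralP (W : finGroupType) (k : W) :
  reflect (central k) (k \in 'Z([set: W])).
Proof.
apply: (iffP (centerP _ _)) => [[_ ck] l | ck]; first exact: ck (in_setT l).
by split=> [|l _]; rewrite ?inE.
Qed.

Lemma noncentral_commute (W : finGroupType) (k : W) :
  k \notin 'Z([set: W]) -> exists l, [~ k, l] != 1.
Proof.
move=> nck; apply/existsP; apply: contraR nck => /existsPn ck.
by apply/center_centralP=> l; apply/commgP; rewrite -[_ == _]negbK ck.
Qed.

Lemma nonabelian_commute (W : finGroupType) :
  ~~ abelian [set: W] -> exists x y : W, [~ x, y] != 1.
Proof.
case/subsetPn=> x _ ncx.
have /noncentral_commute[y nz] : x \notin 'Z([set: W]).
  by rewrite inE negb_and ncx orbT.
by exists x, y.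
Qed.

Section Structure.

Variables (W : finGroupType) (A : zmodType) (t : W -> W -> A) (p n : nat).
Hypothesis tP : crossed_pairing t.
Hypothesis cW : forall g h : W, central [~ g, h].
Hypothesis p_prime : prime p.
Hypothesis oW : #|W| = (p ^ n)%N.

Local Notation D := ([set: W]^`(1)).
Hypothesis oD : #|D| = p.
Hypothesis t_large : forall s : seq A,
  0 \in s -> {in s &, forall u v, u - v \in s} -> (forall g h, t g h \in s) ->
  (p ^ (n.-1 ^ 2 + 2) <= size s)%N.

Let pW : p.-group [set: W].
Proof. by rewrite /pgroup cardsT oW pnatX pnat_id. Qed.

Let indep (x y : W) a b : [~ x, y] != 1 ->
  t [~ x, y] x *+ a + t [~ x, y] y *+ b = 0 -> (p %| a)%N /\ (p %| b)%N.
Proof.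
by move=> nz; apply: (extremal_indep tP cW p_prime oW oD nz t_large).
Qed.

Let not_dvd1 : (p %| 1)%N -> False.
Proof. by rewrite dvdn1; case: eqP p_prime => // ->. Qed.

Let comm_exp (x y : W) u : [~ x, y] != 1 -> u \in D ->
  exists i, u = [~ x, y] ^+ i.
Proof. exact: (der1_comm_exp p_prime oD). Qed.

Section Noncommuting.

Variables x y : W.
Hypothesis nz : [~ x, y] != 1.

Lemma extremal_expp (k : W) : k ^+ p \in D.
Proof.
rewrite -(extremal_Phi tP cW p_prime oW oD nz t_large) (Phi_joing pW).
rewrite (subsetP (joing_subr _ _)) // -{1}(expn1 p) Mho_p_elt ?inE //.
by apply: (mem_p_elt pW); rewrite inE.
Qed.

(** By Jacobi t [x, y] k = 0. If k did not commute with l, then [k, l] would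
    be a power of [x, y], so t [k, l] k = 0 would contradict the
    independence of t [k, l] k and t [k, l] l. *)
Lemma extremal_central (k : W) : [~ k, x] = 1 -> [~ k, y] = 1 -> central k.
Proof.
move=> kx ky l; apply/commgP; apply: contraT => nkl.
have tk : t [~ x, y] k = 0.
  have := pair_Jacobi tP cW x y k.
  by rewrite kx -(invg_comm k y) ky invg1 !(pair1l tP) !addr0.
have [i Ei] := comm_exp nz (commW_der1 k l).
case: not_dvd1; have [] // := indep (a := 1) (b := 0) nkl.
by rewrite Ei (pairZXl tP) // tk mul0rn mul0rn addr0.
Qed.

(** If c^p <> 1, it generates D. But t (c^p) k = p (t c k) = t c (k^p)
    vanishes, because k^p is in D and t c kills commutators; so t [x, y]
    would be zero. *)
Lemma extremal_central_expp (c : W) : central c -> c ^+ p = 1.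
Proof.
move=> cc; apply/eqP; apply: contraT => ncp.
have ccp : central (c ^+ p).
  by move=> k; apply/commute_sym/commuteX/commute_sym/cc.
have tcp k : t (c ^+ p) k = 0.
  rewrite (pairZXl tP) // -(pairZXr tP) //.
  have [i ->] := comm_exp nz (extremal_expp k).
  by rewrite (pairXZr tP) ?(pair_central_comm tP cW) ?mul0rn.
have [i Ei] : exists i, [~ x, y] = (c ^+ p) ^+ i.
  have [j Ej] := comm_exp nz (extremal_expp c).
  apply/cycleP; rewrite Ej in ncp *.
  have : <[[~ x, y] ^+ j]> == D.
    rewrite eqEcard cycle_subG groupX ?commW_der1 //= oD.
    have: (#[[~ x, y] ^+ j] %| p)%N.
      by rewrite -oD cardSg // cycle_subG groupX ?commW_der1.
    case/primeP: p_prime => _ /[apply] /orP[|/eqP oz].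
      by rewrite order_eq1 (negPf ncp).
    by rewrite -{1}oz orderE.
  by move/eqP->; rewrite commW_der1.
case: not_dvd1; have [] // := indep (a := 1) (b := 0) nz.
by rewrite Ei !(pairZXl tP _ _ ccp) !tcp !mul0rn addr0.
Qed.

(** With x^p = z^a and y^p = z^b, subtracting the expansions of t (x^p) y
    and t x (y^p) cancels t x y and leaves (b + C) (t z x) + (a - C) (t z y)
    = 0, where C = 'C(p, 2). The coefficient a - C is written a + C (p - 1)
    to stay in the natural numbers. *)
Lemma extremal_power_relation : exists a b : nat,
  [/\ x ^+ p = [~ x, y] ^+ a, y ^+ p = [~ x, y] ^+ b,
      (p %| b + 'C(p, 2))%N & (p %| a + 'C(p, 2) * p.-1)%N].
Proof.
have [a Ea] := comm_exp nz (extremal_expp x).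
have [b Eb] := comm_exp nz (extremal_expp y).
exists a, b.
have := pairXl tP cW x y p; have := pairXr tP cW x y p; rewrite Ea Eb.
set C := 'C(p, 2).
rewrite (pairZXl tP) // (pairXZr tP) // (pair_skew tP cW x y x).
move=> Ey Ex.
have zyp : t [~ x, y] y *+ p = 0 by apply: (pair_comm_mulrp tP cW oD).
suff E0 : t [~ x, y] x *+ (b + C) + t [~ x, y] y *+ (a + C * p.-1) = 0.
  by have [] := indep nz E0; split.
rewrite !mulrnDr Ex mulrnA.
have -> : t [~ x, y] y *+ C *+ p.-1 = - (t [~ x, y] y *+ C).
  apply/eqP; rewrite -addr_eq0 addrC -mulrS prednK ?prime_gt0 //.
  by rewrite -mulrnA mulnC mulrnA zyp mul0rn.
by rewrite [_ - _ - _]addrAC -Ey mulNrn -opprD addrN.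
Qed.

Lemma extremal_center_abelem : p.-abelem 'Z([set: W]).
Proof.
apply/(abelemP p_prime); split=> [|k /center_centralP].
  exact: center_abelian.
exact: extremal_central_expp.
Qed.

Definition extremal_block := <<[set x; y]>>%G.
Local Notation H := extremal_block.

Let Hx : x \in H. Proof. by rewrite mem_gen ?set21. Qed.
Let Hy : y \in H. Proof. by rewrite mem_gen ?set22. Qed.

Lemma der1_sub_block : D \subset H.
Proof. by rewrite (der1_cycle p_prime oD nz) cycle_subG groupR. Qed.

Lemma der1_sub_center : D \subset 'Z([set: W]).
Proof.
by rewrite (der1_cycle p_prime oD nz) cycle_subG; apply/center_centralP.
Qed.

(** Multiplying k by suitable powers of x and y cancels its commutators with
    x and with y, which makes it central. *)
Lemma block_mul_center : H * 'Z([set: W]) = [set: W].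
Proof.
apply/setP=> k; rewrite inE; set z := [~ x, y].
have zp : z ^+ p = 1 by apply: comm_expp oD _ _.
have [i Ei] := comm_exp nz (commW_der1 k x).
have [j Ej] := comm_exp nz (commW_der1 k y).
(* [k, x] = z^i is cancelled by [y, x]^i, and [k, y] = z^j by [x, y]^(j (p -
   1)). *)
pose h := x ^+ (j * p.-1) * y ^+ i.
have Hh : h \in H by rewrite groupM ?groupX.
have ckh : central (k * h).
  apply: extremal_central; rewrite !(class2_commMl cW) !(class2_commXl cW).
    rewrite Ei commgg expg1n mul1g -(invg_comm x y) -expgMn.
      by rewrite mulgV expg1n.
    exact: cW.
  rewrite Ej commgg expg1n mulg1 -expgD -mulnS prednK ?prime_gt0 //.
  by rewrite mulnC expgM zp expg1n.
apply/mulsgP; exists h^-1 (k * h); rewrite ?groupV //.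
  exact/center_centralP.
by rewrite -(ckh h^-1) mulgK.
Qed.

Lemma block_nonabelian : ~~ abelian H.
Proof.
by apply: contra nz => abH; apply/commgP/(centsP abH).
Qed.

Lemma card_block_le : (#|H| <= p ^ 3)%N.
Proof.
have nDH : H \subset 'N(D) by rewrite (subset_trans (subsetT _)) // der_norm.
rewrite -(Lagrange der1_sub_block) oD -card_quotient //.
rewrite expnS leq_pmul2l ?prime_gt0 //.
have sxyN : [set x; y] \subset 'N(D) by rewrite (subset_trans (subset_gen _)).
have cyc_le (k : W) : k \in H -> (#[coset D k] <= p)%N.
  move=> Hk; rewrite dvdn_leq ?prime_gt0 // order_dvdn.
  have Nk := subsetP nDH k Hk.
  by rewrite -morphX //= coset_id // extremal_expp.
have -> : H / D = <[coset D x]> * <[coset D y]>.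
  rewrite quotient_gen // quotientU !quotient_set1 ?(subsetP nDH) //.
  transitivity (<[coset D x]> <*> <[coset D y]>).
    by rewrite joing_idl joing_idr.
  rewrite comm_joingE //; apply/normC/cents_norm.
  apply: (@sub_abelian_cent2 _ ([set: W] / D)); rewrite ?sub_der1_abelian //.
    by rewrite cycle_subG mem_quotient ?inE.
  by rewrite cycle_subG mem_quotient ?inE.
rewrite (leq_trans _ (leq_mul (cyc_le x Hx) (cyc_le y Hy))) //.
by rewrite mul_cardG leq_pmulr ?cardG_gt0.
Qed.

Lemma block_extraspecial : extraspecial H /\ #|H| = (p ^ 3)%N.
Proof.
have pH : p.-group H := pgroupS (subsetT _) pW.
have [e oH] := p_natP pH.
have e3 : e = 3.
  apply/eqP; rewrite eqn_leq; apply/andP; split.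
    by have := card_block_le; rewrite oH leq_exp2l ?prime_gt1.
  rewrite ltnNge; apply: contra block_nonabelian => e2.
  by apply: (p2group_abelian pH); rewrite oH pfactorK.
rewrite e3 in oH; split=> //.
by apply: (p3group_extraspecial pH block_nonabelian); rewrite oH pfactorK.
Qed.

(** As <x, y> is extraspecial, its centre is its derived subgroup, which is
    a nontrivial subgroup of D, hence all of D. *)
Lemma block_center : 'Z(H) = D.
Proof.
have [[[_ dH] prZ] oH] := block_extraspecial.
rewrite -dH; apply/eqP; rewrite eqEcard dergS ?subsetT //= oD dH.
have pZ : p.-group 'Z(H) := pgroupS (subsetT _) pW.
have : (#|'Z(H)| %| p ^ 3)%N by rewrite -oH cardSg ?center_sub.
by rewrite Euclid_dvdX // dvdn_prime2 // => /andP[/eqP->].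
Qed.

(** A complement of D in the centre of W meets <x, y> trivially, since a
    central element of <x, y> is in D. *)
Lemma extremal_dprod : exists2 E : {group W}, p.-abelem E & H \x E = [set: W].
Proof.
have /splitsP[E /complP[tiDE defZ]] :=
  abelem_splits extremal_center_abelem der1_sub_center.
have sEZ : E \subset 'Z([set: W]) by rewrite -defZ mulG_subr.
exists E; first exact: abelemS sEZ extremal_center_abelem.
have cE (K : {group W}) : E \subset 'C(K).
  by rewrite (subset_trans sEZ) // subIset // centS ?subsetT ?orbT.
rewrite dprodE ?cE //.
  by rewrite -block_mul_center -defZ mulgA (mulGSid der1_sub_block).
have tiDE' : D :&: E = 1 := tiDE.
apply/trivgP; rewrite -tiDE' -block_center subsetI subsetIr andbT.
by rewrite subsetI subsetIl /= (subset_trans (subsetIr _ _)).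
Qed.

(** For p odd, p divides 'C(p, 2), so the power relation gives p %| a. *)
Lemma extremal_odd_expp : odd p -> x ^+ p = 1.
Proof.
move=> odd_p; have [a [b [Ea _ _ pa]]] := extremal_power_relation.
have pC : (p %| 'C(p, 2))%N.
  by apply: prime_dvd_bin => //; rewrite odd_prime_gt2.
move: pa; rewrite dvdn_addl ?dvdn_mulr // => /dvdnP[q Eq].
by rewrite Ea Eq mulnC expgM (comm_expp oD) expg1n.
Qed.

(** For p = 2, 'C(p, 2) = 1 makes a and b odd, so x^2 = y^2 = [x, y]: these
    imply the quaternion relations. *)
Lemma extremal_even_quaternion : p = 2 -> H \isog 'Q_8.
Proof.
move=> p2; have [a [b [Ea Eb pb pa]]] := extremal_power_relation.
rewrite p2 binn /= ?muln1 !addn1 !dvdn2 /= !negbK in Ea Eb pb pa.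
have z2 : [~ x, y] ^+ 2 = 1 by rewrite -[2%N]p2 (comm_expp oD).
have z_odd c : odd c -> [~ x, y] ^+ c = [~ x, y].
  move=> odd_c; rewrite -(odd_double_half c) odd_c expgS.
  by rewrite -mul2n expgM z2 expg1n mulg1.
rewrite !z_odd // in Ea Eb.
have z2x : x ^+ 4 = 1 by rewrite (expgM x 2 2) Ea.
apply/(isoGrpP _ (Grp_quaternion (isT : (2 < 3)%N))).
rewrite card_quaternion //; have [_ ->] := block_extraspecial.
split; first by rewrite p2.
apply/existsP; exists (x, y); rewrite /= !xpair_eqE /= z2x Eb Ea !eqxx andTb /=.
rewrite joing_idl joing_idr eqxx /= conjg_mulR -{1}Ea -expgS.
by rewrite eq_sym eq_invg_mul -expgS z2x.
Qed.

End Noncommuting.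

Lemma extremal_structure : ~~ abelian [set: W] ->
  exists (hT eT : finGroupType) (H : {group hT}) (E : {group eT}),
    [/\ is_E1 p H \/ H \isog 'Q_8, p.-abelem E & [set: W] \isog setX H E].
Proof.
case/nonabelian_commute=> x [y nz].
exists W, W, (extremal_block x y).
have [esH oH] := block_extraspecial nz.
have [E abE defW] := extremal_dprod nz; exists E; split=> //; last first.
  exact: isog_setX defW.
have [p2 | odd_p] := even_prime p_prime.
  by right; apply: extremal_even_quaternion.
left; split=> //.
have expH : (exponent (extremal_block x y) %| p)%N.
  apply/exponentP=> k _.
  have [/center_centralP ck | nck] := boolP (k \in 'Z([set: W])).
    exact: (extremal_central_expp nz ck).
  have [l nkl] := noncentral_commute nck.
  by apply: (extremal_odd_expp nkl).
case/primeP: p_prime => _ /(_ _ expH) /orP[|/eqP//].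
rewrite -dvdn1 -trivg_exponent => /eqP H1.
by move: (block_nonabelian nz); rewrite H1 abelian1.
Qed.

End Structure.

(** * The tensor square as a group *)

Section TensorSquareGroup.

Variable W : groupType.

Definition tens (g h : W) : tensor_square W :=
  \pi_(presented (@tensor_rel W))%qT [:: tensor_letter g h].

Lemma pi_cat (X : choiceType) (R : word X -> word X -> Prop) (u v : word X) :
  (\pi_(presented R)%qT u : presented R) * \pi_(presented R)%qT v =
  \pi_(presented R)%qT (u ++ v).
Proof.
by apply/presented_eqP; apply: word_eq_cat; apply: word_eq_repr.
Qed.

Lemma pi_inv (X : choiceType) (R : word X -> word X -> Prop) (u : word X) :
  (\pi_(presented R)%qT u : presented R)^-1 = \pi_(presented R)%qT (word_inv u).
Proof.
apply: (mulgI (\pi_(presented R)%qT u : presented R)); rewrite mulgV pi_cat.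
by apply/presented_eqP/word_eq_sym/word_eq_mulV.
Qed.

Lemma tens_crossedl g g' h :
  tens (g * g') h = tens (lconj g g') (lconj g h) * tens g h.
Proof.
by rewrite [RHS]pi_cat; apply/presented_eqP/word_eq_rel/tensor_rel_l.
Qed.

Lemma tens_crossedr g h h' :
  tens g (h * h') = tens g h * tens (lconj h g) (lconj h h').
Proof.
by rewrite [RHS]pi_cat; apply/presented_eqP/word_eq_rel/tensor_rel_r.
Qed.

Lemma lconjM (g x y : W) : lconj g (x * y) = lconj g x * lconj g y.
Proof. by rewrite /lconj !mulgA mulgKV. Qed.

Lemma lconj_lconj (g h x : W) : lconj (lconj g h) (lconj g x) = lconj (g * h) x.
Proof. by rewrite /lconj !invMg invgK !mulgA !mulgKV. Qed.

Lemma lconj_comp (g h x : W) : lconj (g * h) x = lconj g (lconj h x).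
Proof. by rewrite /lconj invMg !mulgA. Qed.

(** Expand tens (g g') (h h') starting with the first or with the second
    argument. *)
Lemma tens_conj (g h g' h' : W) :
  tens (lconj (g * h) g') (lconj (g * h) h') * tens g h =
  tens g h * tens (lconj (h * g) g') (lconj (h * g) h').
Proof.
have := erefl (tens (g * g') (h * h')).
rewrite {1}tens_crossedl (lconjM g h) tens_crossedr (tens_crossedr g h).
rewrite (tens_crossedr (g * g')) (tens_crossedl g g' h) (lconjM h g).
rewrite tens_crossedl.
rewrite !lconj_lconj -!mulgA => /mulgI; rewrite !mulgA => /mulIg.
by [].
Qed.

Lemma tensor_ind (P : tensor_square W -> Prop) :
  P 1 -> (forall u v, P u -> P v -> P (u * v)) -> (forall u, P u -> P u^-1) ->
  (forall g h, P (tens g h)) -> forall u, P u.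
Proof.
move=> P1 PM PV Pt u; rewrite -[u]generic_quotient.reprK.
elim: (generic_quotient.repr u) => [//|[[g h] b] w IH].
rewrite -cat1s -pi_cat; apply: PM => //; case: b; last exact: Pt.
by have := PV _ (Pt g h); rewrite pi_inv.
Qed.

End TensorSquareGroup.

Section Lift.

Variables (W : groupType) (A : zmodType) (t : W -> W -> A).
Hypothesis tP : crossed_pairing t.

Definition lift_letter (l : (W * W) * bool) : A :=
  if l.2 then - t l.1.1 l.1.2 else t l.1.1 l.1.2.

Definition lift_word (w : word (W * W)%type) : A := \sum_(l <- w) lift_letter l.

(** The homomorphism from the tensor square to A induced by a crossed
    pairing is computed on a representing word. *)
Definition lift (u : tensor_square W) : A := lift_word (generic_quotient.repr u).

Lemma lift_wordP u v : word_eq (@tensor_rel W) u v -> lift_word u = lift_word v.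
Proof.
elim=> {u v} [||||l|] //.
- by move=> u v w _ -> _ ->.
- move=> u u' v v' _ Eu _ Ev.
  by rewrite /lift_word !big_cat -!/(lift_word _) Eu Ev.
- rewrite /lift_word big_cons big_seq1 big_nil /lift_letter.
  by case: l => [[g h] []] /=; rewrite ?addrN ?addNr.
move=> u v [g g' h|g h h']; rewrite /lift_word big_seq1 big_cons big_seq1.
  exact: tP.1.
exact: tP.2.
Qed.

Lemma lift_pi w : lift (\pi_(presented (@tensor_rel W))%qT w) = lift_word w.
Proof. exact/lift_wordP/word_eq_repr. Qed.

Lemma liftM u v : lift (u * v) = lift u + lift v.
Proof.
rewrite -[u]generic_quotient.reprK -[v]generic_quotient.reprK pi_cat !lift_pi.
by rewrite /lift_word big_cat.
Qed.

Lemma lift_tens g h : lift (tens g h) = t g h.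
Proof. by rewrite lift_pi /lift_word big_seq1. Qed.

End Lift.

Section CommGroupZmod.
Variables (T : groupType) (mulC : commutative (@mulg T)).
Definition comm_group_zmod : zmodType :=
  HB.pack (Group.sort T) (GRing.isZmodule.Build (Group.sort T)
    (@mulgA T) mulC (@mul1g T) (@mulVg T)).
End CommGroupZmod.

(** * Lower bounds from crossed pairings *)

Section LowerBound.

Variables (W : finGroupType) (p m : nat) (v : W -> 'rV['F_p]_m).
Hypothesis p_prime : prime p.
Hypothesis vM : forall g h, v (g * h) = v g + v h.
Hypothesis v_surj : forall r, exists g, v g = r.
Variables (C : zmodType) (psi : W -> W -> C).
Hypothesis psiP : crossed_pairing psi.
Variables (K : finType) (z : W) (h : K -> W).
Hypothesis vz : v z = 0.
Hypothesis psi_inj : injective (fun k => psi z (h k)).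

Let v1 : v 1 = 0.
Proof. by apply: (addrI (v 1)); rewrite -vM mulg1 addr0. Qed.

Let v_lconj g x : v (lconj g x) = v x.
Proof.
by rewrite /lconj !vM addrC addrA -vM mulVg v1 add0r.
Qed.

Let mxP : crossed_pairing (fun g h => ((v g)^T *m v h)%R : 'M['F_p]_m).
Proof.
split=> g g' k /=; rewrite !v_lconj vM.
  by rewrite addrC linearD mulmxDl.
by rewrite mulmxDr.
Qed.

Lemma lift_mx_surj (M : 'M['F_p]_m) :
  exists u, lift (fun g h => ((v g)^T *m v h)%R) u = M.
Proof.
have lift0 : exists u, lift (fun g h => ((v g)^T *m v h)%R) u = 0.
  by exists (tens 1 1); rewrite lift_tens // v1 mulmx0.
rewrite [M]matrix_sum_delta.
elim/big_ind: _ => [|M1 M2 [u1 E1] [u2 E2]|i _].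
- exact: lift0.
- by exists (u1 * u2); rewrite liftM // E1 E2.
elim/big_ind: _ => [|M1 M2 [u1 E1] [u2 E2]|j _].
- exact: lift0.
- by exists (u1 * u2); rewrite liftM // E1 E2.
have [g Eg] := v_surj (M i j *: delta_mx 0 i)%R.
have [k Ek] := v_surj (delta_mx 0 j).
exists (tens g k); rewrite lift_tens // Eg Ek.
by rewrite linearZ /= trmx_delta -scalemxAl mul_delta_mx.
Qed.

(** Choose a preimage of each matrix and multiply it by the elements tens z
    (h k). The latter have matrix 0, so the matrix tells the first factors
    apart, and psi the second ones. *)
Lemma tensor_lower_bound (s : seq (tensor_square W)) :
  (forall u, u \in s) -> (p ^ (m ^ 2) * #|K| <= size s)%N.
Proof.
move=> s_all; have [f fE] := choice lift_mx_surj.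
pose F (Mk : 'M['F_p]_m * K) : tensor_square W := f Mk.1 * tens z (h Mk.2).
have F_inj : injective F.
  move=> [M k] [M' k'] /= E.
  have EM : M = M'.
    have := congr1 (lift (fun g h => ((v g)^T *m v h)%R)) E.
    by rewrite /F !liftM // !lift_tens // vz trmx0 !mul0mx !addr0 !fE.
  congr (_, _) => //; move: E; rewrite /F EM /= => /mulgI.
  by move/(congr1 (lift psi)); rewrite !lift_tens // => /psi_inj.
have : (size (codom F) <= size s)%N.
  by apply: uniq_leq_size; [apply/injectiveP | move=> u _; apply: s_all].
by rewrite size_codom card_prod card_mx card_Fp // mulnn.
Qed.

End LowerBound.

(** * A crossed pairing on the group of order p^3 and exponent p *)

Section HeisenbergGroup.

Variable R : finComNzRingType.

(** The triple (a, b, c) stands for the unitriangular 3 x 3 matrix with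
    entries a, b next to the diagonal and c in the corner. *)
Definition heis : Type := (R * R * R)%type.
HB.instance Definition _ := Finite.on heis.

Definition heis_mul (g h : heis) : heis :=
  ((g.1.1 + h.1.1)%R, (g.1.2 + h.1.2)%R, (g.2 + h.2 + g.1.1 * h.1.2)%R).
Definition heis_inv (g : heis) : heis :=
  ((- g.1.1)%R, (- g.1.2)%R, (g.1.1 * g.1.2 - g.2)%R).
Definition heis_one : heis := (0%R, 0%R, 0%R).

Lemma heis_mulA : associative heis_mul.
Proof.
move=> [[a b] c] [[d e] f] [[g h] k]; rewrite /heis_mul /=.
by congr (_, _, _); ring.
Qed.

Lemma heis_mul1 : left_id heis_one heis_mul.
Proof. by move=> [[a b] c]; rewrite /heis_mul /=; congr (_, _, _); ring. Qed.

Lemma heis_mulV : left_inverse heis_one heis_inv heis_mul.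
Proof.
move=> [[a b] c]; rewrite /heis_mul /heis_inv /heis_one /=.
by congr (_, _, _); ring.
Qed.

HB.instance Definition _ := Finite_isGroup.Build heis
  heis_mulA heis_mul1 heis_mulV.

(** Replace c by s = 2 c - a b, the coordinate of the centre in the Lie
    algebra, up to the factor 2; write v = (a, b), v' = (d, e) and w for the
    determinant of v and v'. The bracket part of the pairing is s v' - u v;
    its failure to be a crossed pairing is cubic in v and v', and, by the
    Jacobi identity in dimension 2, it is corrected by - w (v + v'). The
    factor 2 avoids a division. *)
Definition heis_pairing (g h : heis) : (R * R)%type :=
  let: (a, b, c) := g in let: (d, e, f) := h in
  let s := (c *+ 2 - a * b)%R in let u := (f *+ 2 - d * e)%R in
  let w := (a * e - d * b)%R in
  ((s * d - u * a - w * (a + d))%R, (s * e - u * b - w * (b + e))%R).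

Lemma heis_lconj (g x : heis) :
  lconj g x = (x.1.1, x.1.2, (x.2 + g.1.1 * x.1.2 - x.1.1 * g.1.2)%R).
Proof.
move: g x => [[a b] c] [[d e] f].
rewrite /lconj /= /mulg /invg /= /heis_mul /heis_inv /=.
by congr (_, _, _); ring.
Qed.

Lemma heis_pairingP : crossed_pairing heis_pairing.
Proof.
split; move=> [[a b] c] [[d e] f] [[g h] k]; rewrite !heis_lconj /=;
  by congr (_, _) => /=; ring.
Qed.

Lemma heis_expX i : ((1%R, 0%R, 0%R) : heis) ^+ i = (i%:R, 0, 0)%R.
Proof.
elim: i => // i IH; rewrite expgS IH; congr (_, _, _) => /=;
  by rewrite ?mulr0 ?addr0 ?mulrS.
Qed.

Lemma heis_expY i : ((0%R, 1%R, 0%R) : heis) ^+ i = (0, i%:R, 0)%R.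
Proof.
elim: i => // i IH; rewrite expgS IH; congr (_, _, _) => /=;
  by rewrite ?mul0r ?addr0 ?mulrS.
Qed.

Lemma heis_pairing_center a b c :
  heis_pairing (0, 0, 1)%R (a, b, c) = (a *+ 2, b *+ 2)%R.
Proof. by rewrite /heis_pairing; congr (_, _); ring. Qed.

End HeisenbergGroup.

(** * A crossed pairing on the quaternion group *)

Section QuaternionModel.

(** The triple (a, b, c) stands for x^a y^b z^c, where x^2 = y^2 = z = [x,
    y]. *)
Definition quat : Type := (bool * bool * bool)%type.
HB.instance Definition _ := Finite.on quat.

Definition quat_mul (g h : quat) : quat :=
  let: (a, b, c) := g in let: (d, e, f) := h in
  (a (+) d, b (+) e, c (+) f (+) (a && d) (+) (b && e) (+) (b && d)).
Definition quat_one : quat := (false, false, false).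
Definition quat_inv (g : quat) : quat :=
  let: (a, b, c) := g in (a, b, c (+) a (+) b (+) (a && b)).

Lemma quat_mulA : associative quat_mul.
Proof. by do 3!case=> [[[] []] []]. Qed.

Lemma quat_mul1 : left_id quat_one quat_mul.
Proof. by case=> [[[] []] []]. Qed.

Lemma quat_mulV : left_inverse quat_one quat_inv quat_mul.
Proof. by case=> [[[] []] []]. Qed.

HB.instance Definition _ := Finite_isGroup.Build quat
  quat_mulA quat_mul1 quat_mulV.

(** A solution modulo 4 of the linear equations that express crossed
    pairings on the 8 elements, chosen so that z paired with x is (2, 0),
    and z paired with y is (0, 2). Since 2 (t x x) = t (x^2) x = t z x, a
    pairing with values of exponent 2 would kill t z x. *)
Definition quat_pairing (g h : quat) : 'Z_4 * 'Z_4 :=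
  let: (a, b, c) := g in let: (d, e, f) := h in
  (inZp (a * d + a * e + b * d + 2 * (c * d + a * f + a * d * e + a * b * d)),
   inZp (a * e + b * e + b * d + 2 * (c * e + b * f)))%N.

Lemma quat_pairingP : crossed_pairing quat_pairing.
Proof.
have eqZ (u v : 'Z_4 * 'Z_4) : (u == v) -> u = v by move/eqP.
by split; do 3!case=> [[[] []] []]; apply: eqZ; vm_compute.
Qed.

End QuaternionModel.

(** * Groups that split as H x E attain the bound *)

Section GroupLowerBound.

Lemma mulg_morph1 (W U : groupType) (f : W -> U) :
  {morph f : g h / g * h} -> f 1 = 1.
Proof.
by move=> fM; apply: (mulgI (f 1)); rewrite -fM !mulg1.
Qed.

Lemma mulg_morphV (W U : groupType) (f : W -> U) :
  {morph f : g h / g * h} -> forall g, f g^-1 = (f g)^-1.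
Proof.
by move=> fM g; apply: (mulgI (f g)); rewrite -fM !mulgV mulg_morph1.
Qed.

Lemma mulg_morph_lconj (W U : groupType) (f : W -> U) :
  {morph f : g h / g * h} -> forall g x, f (lconj g x) = lconj (f g) (f x).
Proof.
by move=> fM g x; rewrite /lconj !fM (mulg_morphV fM).
Qed.

Lemma crossed_pairing_comp (W U : groupType) (A : zmodType) (f : W -> U)
    (t : U -> U -> A) :
  {morph f : g h / g * h} -> crossed_pairing t ->
  crossed_pairing (fun g h => t (f g) (f h)).
Proof.
move=> fM [tl tr]; split=> g h k; rewrite fM !(mulg_morph_lconj fM).
  exact: tl.
exact: tr.
Qed.

Lemma mulg_morphR (W U : groupType) (f : W -> U) :
  {morph f : g h / g * h} -> forall x y, f [~ x, y] = [~ f x, f y].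
Proof. by move=> fM x y; rewrite /commg /conjg !fM !(mulg_morphV fM). Qed.

Lemma mulg_morphX (W U : groupType) (f : W -> U) :
  {morph f : g h / g * h} -> forall x i, f (x ^+ i) = f x ^+ i.
Proof.
by move=> fM x; elim=> [|i IH]; rewrite ?(mulg_morph1 fM) // !expgS fM IH.
Qed.

Variables (W : finGroupType) (p n : nat).
Hypothesis p_prime : prime p.
Hypothesis oW : #|W| = (p ^ n)%N.
Local Notation D := ([set: W]^`(1)).
Hypothesis oD : #|D| = p.
Hypothesis Wp : forall k : W, k ^+ p \in D.

Variables (U : groupType) (f : W -> U) (C : zmodType) (psi : U -> U -> C).
Hypothesis fM : {morph f : g h / g * h}.
Hypothesis psiP : crossed_pairing psi.
Variables (K : finType) (x y : W) (h : K -> W).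
Hypothesis nz : [~ x, y] != 1.
Hypothesis psi_inj : injective (fun k => psi (f [~ x, y]) (f (h k))).

(** The quotient by the derived subgroup is elementary abelian, and its
    coordinates supply the matrix part; the pairing pulled back from U
    supplies the rest. *)
Lemma tensor_lower_bound_group (s : seq (tensor_square W)) :
  (forall u, u \in s) -> (p ^ (n.-1 ^ 2) * #|K| <= size s)%N.
Proof.
have abW : p.-abelem ([set: W] / D).
  apply/abelemP => //; split; first exact: sub_der1_abelian.
  move=> _ /morphimP[k Nk _ ->]; rewrite -morphX //; exact: coset_id.
have oWD : #|[set: W] / D| = (p ^ n.-1)%N.
  by rewrite card_quotient ?der_norm //; apply: index_der1 nz.
have ntW : [set: W] / D != 1.
  rewrite -cardG_gt1 oWD.
  have n2 : (2 < n)%N := noncommuting_card_gt2 p_prime oW nz.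
  have := ltn_exp2l 0 n.-1 (prime_gt1 p_prime).
  by rewrite expn0 => ->; rewrite -ltnS prednK ?(ltn_trans _ n2).
pose v g := abelem_rV abW ntW (coset D g).
have inQ g : coset D g \in [set: W] / D by rewrite mem_quotient ?inE.
have nD g : g \in 'N(D) by rewrite (subsetP (der_norm 1 [set: W])) ?inE.
have vM g k : v (g * k) = (v g + v k)%R.
  by rewrite /v (morphM (coset_morphism D)) ?nD // (abelem_rV_M abW ntW) ?inQ.
have v_surj r : exists g, v g = r.
  have /morphimP[g _ _ Eg] := mem_rVabelem abW ntW r.
  by exists g; rewrite /v -Eg rVabelemK.
have vz : v [~ x, y] = 0%R.
  rewrite /v coset_id ?commW_der1 //; exact: morph1.
have psifP := crossed_pairing_comp fM psiP.
move=> /(tensor_lower_bound p_prime vM v_surj psifP vz psi_inj).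
by rewrite (dim_abelemE abW ntW) oWD pfactorK.
Qed.

End GroupLowerBound.

Section ModelMorphisms.

(** The elements (1, 0, 0) and (0, 1, 0) satisfy the relations that present
    p^{1+2}. *)
Lemma heis_homg (p : nat) (pr : prime p) :
  exists2 f : {morphism [set: p^{1+2}] >-> heis 'F_p},
   (exists x, f x = (1%R, 0%R, 0%R)) & (exists y, f y = (0%R, 1%R, 0%R)).
Proof.
pose X : heis 'F_p := (1%R, 0%R, 0%R); pose Y : heis 'F_p := (0%R, 1%R, 0%R).
have cen (g : heis 'F_p) : [~ X, Y, g] = 1.
  by case: g => [[a b] c]; congr (_, _, _) => /=; ring.
have p0 : (p%:R = 0 :> 'F_p)%R by apply: pchar_Fp_0.
have Xp : X ^+ p = 1 by rewrite heis_expX p0.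
have Yp : Y ^+ p = 1 by rewrite heis_expY p0.
have /homgP[f im_f] : <[X]> <*> <[Y]> \homg [set: p^{1+2}].
  rewrite (Grp_pX1p2 pr); apply/existsP; exists (X, Y).
  by rewrite /= Xp Yp (cen X) (cen Y).
exists f.
  have : X \in f @* [set: p^{1+2}] by rewrite im_f mem_gen // inE cycle_id.
  by case/morphimP=> x _ _ Ex; exists x; rewrite -Ex.
have : Y \in f @* [set: p^{1+2}] by rewrite im_f mem_gen // inE cycle_id orbT.
by case/morphimP=> x _ _ Ex; exists x; rewrite -Ex.
Qed.

Lemma quat_homg :
  exists2 f : {morphism [set: 'Q_8] >-> quat},
   (exists x, f x = (true, false, false)) &
   (exists y, f y = (false, true, false)).
Proof.
pose X : quat := (true, false, false); pose Y : quat := (false, true, false).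
have /homgP[f im_f] : <[X]> <*> <[Y]> \homg [set: 'Q_8].
  rewrite (Grp_quaternion (isT : 2 < 3)%N); apply/existsP; exists (X, Y).
  by rewrite /= !xpair_eqE /= eqxx.
exists f.
  have : X \in f @* [set: 'Q_8] by rewrite im_f mem_gen // inE cycle_id.
  by case/morphimP=> x _ _ Ex; exists x; rewrite -Ex.
have : Y \in f @* [set: 'Q_8] by rewrite im_f mem_gen // inE cycle_id orbT.
by case/morphimP=> x _ _ Ex; exists x; rewrite -Ex.
Qed.

End ModelMorphisms.

Section Converse.

Variables (W : finGroupType) (p n : nat).
Hypothesis p_prime : prime p.
Hypothesis oW : #|W| = (p ^ n)%N.
Local Notation D := ([set: W]^`(1)).
Hypothesis oD : #|D| = p.

(** In an extraspecial group p-th powers lie in the Frattini subgroup, which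
    is the derived subgroup; in E they are trivial. *)
Lemma setX_extraspecial_expp (hT eT : finGroupType) (H : {group hT})
    (E : {group eT}) :
  extraspecial H -> p.-abelem E -> [set: W] \isog setX H E ->
  forall k : W, k ^+ p \in D.
Proof.
move=> esH abE /isogP[f injf imf] k.
have kW : k \in [set: W] by rewrite inE.
have : f k \in setX H E by rewrite -imf mem_morphim.
case Ef: (f k) => [a b] /setXP[Ha Eb].
have pH : p.-group H.
  have /pgroupP : p.-group (setX H E).
    by rewrite -imf morphim_pgroup // /pgroup cardsT oW pnatX pnat_id.
  move=> pHE; apply/pgroupP=> q q_pr qH; apply: pHE => //.
  by rewrite cardsX dvdn_mulr.
have [[PhiZ dZ] _] := esH.
have Hap : a ^+ p \in H^`(1).
  rewrite dZ -PhiZ (Phi_joing pH) (subsetP (joing_subr _ _)) //.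
  by rewrite -{1}(expn1 p) Mho_p_elt // (mem_p_elt pH).
have Ebp : b ^+ p = 1 by have [_ ->] := abelemP p_prime abE.
have : f (k ^+ p) \in f @* D.
  rewrite morphX // Ef morphim_der // imf.
  have -> : (a, b) ^+ p = pairg1 eT (a ^+ p).
    by rewrite /pairg1 -Ebp; elim: (p) => // i IH; rewrite !expgS IH.
  have sHE : pairg1 eT @* H^`(1) \subset (setX H E)^`(1).
    by rewrite morphim_der ?subsetT // morphim_pairg1 dergS // setXS ?sub1G.
  by rewrite (subsetP sHE) // mem_morphim ?inE.
case/morphimP=> d _ Dd /(injmP injf) ->; rewrite ?groupX //.
Qed.

Lemma map_onto_model (hT eT mT uT : finGroupType) (H : {group hT})
    (E : {group eT})
    (f : {morphism [set: mT] >-> uT}) (X Y : mT) :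
  [set: W] \isog setX H E -> H \isog [set: mT] ->
  exists F : W -> uT, {morph F : g h / g * h} /\
    (exists x, F x = f X) /\ (exists y, F y = f Y).
Proof.
case/isogP=> e _ ime /isogP[k _ imk].
have eH g : (e g).1 \in H.
  have : e g \in setX H E by rewrite -ime mem_morphim ?inE.
  by case: (e g) => a b /setXP[].
exists (fun g => f (k (e g).1)); split=> [g h|].
  by rewrite morphM ?inE //= morphM // morphM ?inE.
have surj Z : exists x, f (k (e x).1) = f Z.
  have : Z \in k @* H by rewrite imk inE.
  case/morphimP=> h _ Hh ->.
  have : (h, 1) \in e @* [set: W] by rewrite ime inE /= Hh group1.
  by case/morphimP=> x _ _ Ex; exists x; rewrite -Ex.
by split; apply: surj.
Qed.

Lemma tensor_lower_bound_E1 (hT eT : finGroupType) (H : {group hT})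
    (E : {group eT}) (s : seq (tensor_square W)) :
  is_E1 p H -> p.-abelem E -> [set: W] \isog setX H E ->
  (forall u, u \in s) -> (p ^ (n.-1 ^ 2 + 2) <= size s)%N.
Proof.
move=> [esH oH expH] abE isoW s_all.
have Wp := setX_extraspecial_expp esH abE isoW.
have odd_p : odd p.
  case: (even_prime p_prime) => // p2.
  case/negP: (extraspecial_nonabelian esH).
  by apply: (abelem_abelian (p := 2)); rewrite exponent2_abelem // expH p2.
have isoH : H \isog [set: p^{1+2}] by rewrite isog_pX1p2 // expH.
have [f [X0 fX] [Y0 fY]] := heis_homg p_prime.
have [F [FM [[x Fx] [y Fy]]]] := map_onto_model f X0 Y0 isoW isoH.
rewrite {}fX in Fx; rewrite {}fY in Fy.
have Fz : F [~ x, y] = (0, 0, 1)%R.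
  rewrite (mulg_morphR FM) Fx Fy; congr (_, _, _) => /=; ring.
have nz : [~ x, y] != 1.
  apply/eqP=> z1; have := Fz; rewrite z1.
  rewrite (mulg_morph1 FM).
  by case=> /eqP; rewrite eq_sym oner_eq0.
pose h (ab : 'F_p * 'F_p) := x ^+ ab.1 * y ^+ ab.2.
have Fh a b : F (h (a, b)) = (a, b, a * b)%R.
  rewrite /h FM !(mulg_morphX FM) Fx Fy.
  by rewrite heis_expX heis_expY !natr_Zp; congr (_, _, _) => /=; ring.
have inj : injective (fun ab => heis_pairing (F [~ x, y]) (F (h ab))).
  have n2 : (2%:R != 0 :> 'F_p)%R.
    rewrite -(dvdn_pcharf (pchar_Fp p_prime)) dvdn_prime2 //.
    by case: eqP odd_p => // ->.
  move=> [a b] [c d]; rewrite Fz (Fh a b) (Fh c d).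
  rewrite (heis_pairing_center a) (heis_pairing_center c).
  rewrite -(mulr_natr a) -(mulr_natr b) -(mulr_natr c) -(mulr_natr d).
  move=> eq_ab.
  have /(mulIf n2) -> : (a * 2%:R = c * 2%:R)%R := congr1 fst eq_ab.
  by have /(mulIf n2) -> : (b * 2%:R = d * 2%:R)%R := congr1 snd eq_ab.
have heisP := @heis_pairingP 'F_p.
have := tensor_lower_bound_group p_prime oW oD Wp FM heisP nz inj s_all.
by rewrite card_prod card_Fp // mulnn expnD.
Qed.

Lemma tensor_lower_bound_Q8 (hT eT : finGroupType) (H : {group hT})
    (E : {group eT}) (s : seq (tensor_square W)) :
  H \isog 'Q_8 -> p.-abelem E -> [set: W] \isog setX H E ->
  (forall u, u \in s) -> (p ^ (n.-1 ^ 2 + 2) <= size s)%N.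
Proof.
move=> isoH abE isoW s_all.
have esH : extraspecial H.
  by apply: isog_extraspecial Q8_extraspecial; rewrite isog_sym.
have Wp := setX_extraspecial_expp esH abE isoW.
have p2 : p = 2.
  have : (2 %| p ^ n)%N.
    rewrite -oW -cardsT (card_isog isoW) cardsX dvdn_mulr //.
    by rewrite (card_isog isoH) (@card_quaternion 3).
  by rewrite Euclid_dvdX // dvdn_prime2 // => /andP[/eqP].
have [f [X0 fX] [Y0 fY]] := quat_homg.
have [F [FM [[x Fx] [y Fy]]]] := map_onto_model f X0 Y0 isoW isoH.
rewrite {}fX in Fx; rewrite {}fY in Fy.
have Fz : F [~ x, y] = (false, false, true) by rewrite (mulg_morphR FM) Fx Fy.
have nz : [~ x, y] != 1.
  apply/eqP=> z1; have := Fz; rewrite z1.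
  rewrite (mulg_morph1 FM).
  by [].
pose h (ab : bool * bool) := x ^+ ab.1 * y ^+ ab.2.
have inj : injective (fun ab => quat_pairing (F [~ x, y]) (F (h ab))).
  move=> ab cd; rewrite Fz /h !FM !(mulg_morphX FM) Fx Fy.
  by case: ab cd => [[] []] [[] []].
have := tensor_lower_bound_group p_prime oW oD Wp FM quat_pairingP nz inj s_all.
by rewrite card_prod card_bool p2 mulnn expnD.
Qed.

End Converse.

(** * The order of the tensor square *)

Section Cardinality.
Local Open Scope classical_set_scope.
Local Open Scope card_scope.

Lemma seq_cover_card_le (T : choiceType) (x0 : T) (s : seq T) (N : nat) :
  (forall u, u \in s) -> (size s <= N)%N -> [set: T] #<= `I_N.
Proof.
move=> s_all le_sN.
apply: (@card_le_trans _ _ _ `I_(size s)); last by rewrite card_le_II.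
apply: card_le_trans (card_image_le (nth x0 s) `I_(size s)).
apply: subset_card_le => u _; exists (index u s); last by rewrite nth_index.
by rewrite /= index_mem.
Qed.

(** A covering list of minimal size has no duplicates, so it is an
    enumeration. *)
Lemma seq_cover_card_eq (T : choiceType) (x0 : T) (s : seq T) (N : nat) :
  (forall u, u \in s) -> (size s <= N)%N ->
  ([set: T] #= `I_N <->
   forall s' : seq T, (forall u, u \in s') -> (N <= size s')%N).
Proof.
move=> s_all le_sN; split=> [eqTN s' s'_all | minN].
  rewrite -card_le_II -(card_le_eql eqTN).
  exact: seq_cover_card_le s'_all (leqnn _).
pose u := undup s.
have u_all x : x \in u by rewrite mem_undup.
have size_u : size u = N.
  by apply/eqP; rewrite eqn_leq minN // (leq_trans (size_undup s)).
rewrite -size_u; have -> : [set: T] = nth x0 u @` `I_(size u).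
  apply/seteqP; split=> // x _; exists (index x u); last by rewrite nth_index.
  by rewrite /= index_mem.
apply: inj_card_eq => i j /set_mem iu /set_mem ju /eqP.
by rewrite nth_uniq ?undup_uniq // => /eqP.
Qed.

End Cardinality.

Section MainForWholeGroup.

Variables (W : finGroupType) (p n : nat).
Hypothesis p_prime : prime p.
Hypothesis oW : #|W| = (p ^ n)%N.
Hypothesis nabW : ~~ abelian [set: W].
Hypothesis oD : #|[set: W]^`(1)| = p.

Lemma central_commW (g h : W) : central [~ g, h].
Proof.
have pW : p.-group [set: W] by rewrite /pgroup cardsT oW pnatX pnat_id.
have sDZ : [set: W]^`(1) \subset 'Z([set: W]).
  apply: prime_meetG; first by rewrite oD.
  apply: meet_center_nil (pgroup_nil pW) (der_normal 1 _) _.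
  by rewrite -cardG_gt1 oD prime_gt1.
by apply/center_centralP/(subsetP sDZ)/commW_der1.
Qed.

(** Conjugation by tens g h is the action of [g, h], by tens_conj, and [g,
    h] is central. *)
Lemma tensor_mulC : commutative (@mulg (tensor_square W)).
Proof.
have commV (a b : tensor_square W) : commute a b -> commute a^-1 b.
  by move=> ab; apply/commute_sym/commuteV/commute_sym.
have tens_comm (g h a b : W) : commute (tens g h) (tens a b).
  have lconj_comm x : lconj (h * g) x = lconj (g * h) x.
    rewrite (class2_mulC central_commW g h) [RHS]lconj_comp.
    by rewrite (lconj_central_l _ (central_commW g h)).
  have := tens_conj g h (lconj (g * h)^-1 a) (lconj (g * h)^-1 b).
  by rewrite !lconj_comm -!lconj_comp mulgV /lconj !mul1g invg1 !mulg1.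
suff: forall u v : tensor_square W, commute u v by [].
move=> u v; elim/tensor_ind: u => [|a b Ha Hb|a Ha|g h].
- exact/commute_sym/commute1.
- by apply/commute_sym/commuteM; apply: commute_sym.
- exact: commV.
elim/tensor_ind: v => [|a b Ha Hb|a Ha|a b].
- exact: commute1.
- exact: commuteM.
- exact: commuteV.
exact: tens_comm.
Qed.

Definition tensor_zmod : zmodType := comm_group_zmod tensor_mulC.

Lemma tens_crossed : crossed_pairing (tens (W := W) : W -> W -> tensor_zmod).
Proof. by split=> g g' h; [apply: tens_crossedl | apply: tens_crossedr]. Qed.

Lemma tens_span (s : seq tensor_zmod) :
  (0 \in s)%R -> {in s &, forall u v, (u - v \in s)%R} ->
  (forall g h : W, (tens g h : tensor_zmod) \in s) ->
  forall u : tensor_square W, u \in (s : seq (tensor_square W)).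
Proof.
move=> s0 sB st.
have sN (u : tensor_zmod) : u \in s -> (- u \in s)%R.
  by move=> su; rewrite -sub0r sB.
elim/tensor_ind=> [|u v su sv|u su|g h].
- exact: s0.
- have := sB u (- (v : tensor_zmod))%R su (sN v sv).
  by rewrite opprK.
- exact: (sN u su).
exact: st.
Qed.

Lemma tensor_square_order :
  ([set: tensor_square W]%classic #<= `I_(p ^ (n.-1 ^ 2 + 2))%N)%card
  /\ (([set: tensor_square W]%classic #= `I_(p ^ (n.-1 ^ 2 + 2))%N)%card
      <-> exists (hT eT : finGroupType) (H : {group hT}) (E : {group eT}),
            [/\ is_E1 p H \/ H \isog 'Q_8,
                p.-abelem E
              & [set: W] \isog setX H E]).
Proof.
have [x [y nz]] := nonabelian_commute nabW.
have [s [size_s s0 sB st]] :=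
  pair_upper_bound tens_crossed central_commW p_prime oW oD nz.
have s_all := tens_span s0 sB st.
split; first exact: (seq_cover_card_le 1 s_all size_s).
rewrite (seq_cover_card_eq 1 s_all size_s); split=> [min | ].
  apply: (extremal_structure tens_crossed central_commW p_prime oW oD _ nabW).
  by move=> s' s'0 s'B s't; apply: min; apply: tens_span.
case=> hT [eT [H [E [[HE1|HQ8] abE isoW]]]] s' s'_all.
  exact: tensor_lower_bound_E1 HE1 abE isoW s'_all.
exact: tensor_lower_bound_Q8 HQ8 abE isoW s'_all.
Qed.

End MainForWholeGroup.

Local Open Scope card_scope.

Theorem theorem2p6 (gT : finGroupType) (G : {group gT}) (p n : nat)
    (p_prime : prime p) (oG : #|G| = (p ^ n)%N)
    (nabG : ~~ abelian G) (oG' : #|G^`(1)| = p) :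
  [set: tensor_square (subg_of G)]%classic
    #<= `I_(p ^ ((n - 1) ^ 2 + 2))%N
  /\ ([set: tensor_square (subg_of G)]%classic
        #= `I_(p ^ ((n - 1) ^ 2 + 2))%N
      <-> exists (hT eT : finGroupType) (H : {group hT}) (E : {group eT}),
            [/\ is_E1 p H \/ H \isog 'Q_8,
                p.-abelem E
              & G \isog setX H E]).
Proof.
have isoG : G \isog [set: subg_of G] by apply: isog_subg.
have oW : #|subg_of G| = (p ^ n)%N by rewrite -oG (card_isog isoG) cardsT.
have nabW : ~~ abelian [set: subg_of G] by rewrite -(isog_abelian isoG).
have oW' : #|[set: subg_of G]^`(1)| = p.
  have /isogP[f injf <-] := isoG.
  by rewrite -morphim_der // card_injm // der_sub.
have [le_card eq_card] := tensor_square_order p_prime oW nabW oW'.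
rewrite subn1; split=> //; rewrite eq_card.
by split=> -[hT [eT [H [E [HH abE isoX]]]]]; exists hT, eT, H, E; split=> //;
   [exact: isog_trans isoG isoX | rewrite -(isog_transl _ isoG)].
Qed.
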